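(* Let $G\in\mathbb{CR}$ and suppose that, for some Left move indices $i$ and $j$ with $i\neq j$, 1. $G^{i,\cdot}\succeq G^{j,\cdot}$; and 2. for all $r$ there exists $s$ with $G^{i,r}\succeq G^{j,s}$ (where $r,s$ range over indices of Right's moves in $G$). Let $H$ be the game $G$ without Left's move $G(j,\cdot)$. Then $H=G$.
   Context: Short cr-games (Cheating Robot games). The set $\mathbb{CR}$ of short cr-games (positions) is defined recursively. A position $G$ consists of a finite list $G(L)$ of $m\ge 0$ Left moves $G(i,\cdot)$, a finite list $G(R)$ of $n\ge 0$ Right moves $G(\cdot,j)$, and, for each $i$ a Left option $G^{i,\cdot}$, for each $j$ a Right option $G^{\cdot,j}$, and for each pair $(i,j)$ a same-round option $G^{i,j}$, all options being previously constructed positions. One writes $G=\{G^L\mid S(G)\mid G^R\}$, where $G^L$, $G^R$ are the lists of Left and Right options and $S(G)$ is the $m\times n$ matrix with entries $G^{i,j}$ ($S(G)=\emptyset$ if $m=0$ or $n=0$). The base case is $0=\{\,\cdot\mid\cdot\mid\cdot\,\}$ (no moves); a dot denotes an empty list. Removing Left's move $G(j,\cdot)$ means deleting that move together with its Left option $G^{j,\cdot}$ and all same-round options $G^{j,s}$, leaving everything else unchanged. Outcomes. Play proceeds in rounds: from $G$, Left chooses a move $G(i,\cdot)$; then Right, knowing Left's choice, chooses $G(\cdot,j)$; the new position is $G^{i,j}$. If $S(G)=\emptyset$: $o(G)=\mathcal L$ (Left wins) if $G(L)\ne\emptyset$; $o(G)=\mathcal R$ (Right wins) if $G(R)\neq\emptyset$;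 otherwise $o(G)=\mathcal D$ (draw). If $S(G)\ne\emptyset$: $o(G)=\mathcal L$ if Left can force a win, $o(G)=\mathcal R$ if Right can force a win, otherwise $o(G)=\mathcal D$. Outcomes are totally ordered by $\mathcal L>\mathcal D>\mathcal R$. Disjunctive sum. $G+H$ has Left moves $G(i,\cdot)+H$ and $G+H(k,\cdot)$ with Left options $G^{i,\cdot}+H$ and $G+H^{k,\cdot}$; Right moves $G(\cdot,j)+H$ and $G+H(\cdot,l)$ with Right options $G^{\cdot,j}+H$ and $G+H^{\cdot,l}$; and same-round options $G^{i,j}+H$ (both move in $G$), $G+H^{k,l}$ (both move in $H$), $G^{i,\cdot}+H^{\cdot,l}$ (Left in $G$, Right in $H$), $G^{\cdot,j}+H^{k,\cdot}$ (Left in $H$, Right in $G$). Equality and order. For $G,H\in\mathbb{CR}$: $G=H$ if $o(G+X)=o(H+X)$ for all $X\in\mathbb{CR}$; $G\succeq H$ if $o(G+X)\ge o(H+X)$ for all $X\in\mathbb{CR}$. *)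

(* Defs.v *)
From mathcomp Require Import all_boot.

Set Implicit Arguments.
Unset Strict Implicit.
Unset Printing Implicit Defensive.

Declare Scope cr_scope.
Delimit Scope cr_scope with CR.

(* A short cr-game with m Left moves and n Right moves. Finite lists and the
   m x n matrix S(G) are encoded as functions on ordinals; S(G) is empty
   exactly when m = 0 or n = 0. The game 0 is the case m = n = 0. *)
Inductive crgame : Type :=
  CRGame (m n : nat) of ('I_m -> crgame) & ('I_n -> crgame)
    & ('I_m -> 'I_n -> crgame).

Definition nleft (G : crgame) : nat := let: CRGame m _ _ _ _ := G in m.

Definition nright (G : crgame) : nat := let: CRGame _ n _ _ _ := G in n.

Definition left_option (G : crgame) : 'I_(nleft G) -> crgame :=
  let: CRGame _ _ GL _ _ := G in GL.

Definition right_option (G : crgame) : 'I_(nright G) -> crgame :=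
  let: CRGame _ _ _ GR _ := G in GR.

Definition round_option (G : crgame) :
    'I_(nleft G) -> 'I_(nright G) -> crgame :=
  let: CRGame _ _ _ _ GS := G in GS.

(* [lift j] enumerates, in order, the indices different from j. *)
Definition remove_left (G : crgame) (j : 'I_(nleft G)) : crgame :=
  CRGame (fun k : 'I_(nleft G).-1 => left_option (lift j k))
         (@right_option G)
         (fun (k : 'I_(nleft G).-1) r => round_option (lift j k) r).

(* In each round Left chooses first and Right replies knowing Left's choice,
   whence the order of the quantifiers below. When S(G) is empty, Left wins if
   Left has a move and Right wins if Right has a move (not both can occur). *)
Fixpoint left_forces_win (G : crgame) : bool :=
  let: CRGame m n _ _ GS := G in
  if (m == 0) || (n == 0) then 0 < m
  else [exists i, [forall j, left_forces_win (GS i j)]].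

Fixpoint right_forces_win (G : crgame) : bool :=
  let: CRGame m n _ _ GS := G in
  if (m == 0) || (n == 0) then 0 < n
  else [forall i, [exists j, right_forces_win (GS i j)]].

Variant outcome : Type := LeftWins | Draw | RightWins.

Definition outcome_of (G : crgame) : outcome :=
  if left_forces_win G then LeftWins
  else if right_forces_win G then RightWins
  else Draw.

(* LeftWins > Draw > RightWins *)
Definition outcome_rank (o : outcome) : nat :=
  match o with LeftWins => 2 | Draw => 1 | RightWins => 0 end.

Definition outcome_ge (o1 o2 : outcome) : bool :=
  outcome_rank o2 <= outcome_rank o1.

(* Disjunctive sum; [split] sends an index of 'I_(m + p) to [inl] when the move
   is made in G and to [inr] when it is made in H. *)
Fixpoint cradd (G : crgame) : crgame -> crgame :=
  match G with
  | CRGame m n GL GR GS =>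
    fix cradd_G (H : crgame) : crgame :=
      match H with
      | CRGame p q HL HR HS =>
        CRGame
          (fun a : 'I_(m + p) =>
             match split a with
             | inl i => cradd (GL i) H
             | inr k => cradd_G (HL k)
             end)
          (fun b : 'I_(n + q) =>
             match split b with
             | inl j => cradd (GR j) H
             | inr l => cradd_G (HR l)
             end)
          (fun (a : 'I_(m + p)) (b : 'I_(n + q)) =>
             match split a, split b with
             | inl i, inl j => cradd (GS i j) H
             | inr k, inr l => cradd_G (HS k l)
             | inl i, inr l => cradd (GL i) (HR l)
             | inr k, inl j => cradd (GR j) (HL k)
             end)
      end
  end.

Notation "G + H" := (cradd G H) : cr_scope.

(* Equality of games is indistinguishability in every sum, not Leibniz
   equality. *)
Definition cr_eq (G H : crgame) : Prop :=
  forall X : crgame, outcome_of (G + X)%CR = outcome_of (H + X)%CR.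

Definition cr_ge (G H : crgame) : Prop :=
  forall X : crgame, outcome_ge (outcome_of (G + X)%CR) (outcome_of (H + X)%CR).

(* Main.v *)
Require Import Defs.
From mathcomp Require Import all_boot.

(** Fix X and compare play in G + X with play in H + X, where H is G without
the move j; the argument is by induction on X.

Everything in H + X is also available in G + X, and the only extra resource of
Left in G + X is the move j. Left loses nothing by playing i instead: if Right
answers in X, the position is the Left option of i plus a Right option of X,
which is at least as good for Left as what j would have given by the first
hypothesis; if Right answers in G by some r, the second hypothesis provides an
answer s to j that would have been at least as good for Right. When both
players move in X, the two sums are compared again with a smaller X. No other
round leaves H and G in play, and the remaining positions coincide.

[outcome_ge_simulation] turns such an imitation of moves into an inequality of
outcomes, in one stroke for the wins of Left and for those of Right, and
[outcome_ge_add] restates it for sums. The removal of j does not make the set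
of Left moves empty, as i remains; so the rule that decides the game when
a player cannot move does not tell the two sums apart. *)

Lemma left_forces_winE G : left_forces_win G =
  if (nleft G == 0) || (nright G == 0) then 0 < nleft G
  else [exists a, [forall b, left_forces_win (@round_option G a b)]].
Proof. by case: G. Qed.

Lemma right_forces_winE G : right_forces_win G =
  if (nleft G == 0) || (nright G == 0) then 0 < nright G
  else [forall a, [exists b, right_forces_win (@round_option G a b)]].
Proof. by case: G. Qed.

Lemma not_both_force_win G : left_forces_win G -> ~~ right_forces_win G.
Proof.
elim: G => m n GL _ GR _ GS IH.
rewrite left_forces_winE right_forces_winE /=.
case: ifP => [/orP[] /eqP-> // | _ /existsP[a /forallP winL]].
by apply/forallPn; exists a; apply/existsPn => b; apply: IH.
Qed.

(** The definition of [outcome_of] tests the wins of Left first; as the two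
players cannot both force a win, the order on outcomes is nevertheless the
symmetric condition below. *)
Lemma outcome_geP A B :
  outcome_ge (outcome_of B) (outcome_of A) <->
  (left_forces_win A -> left_forces_win B) /\
  (right_forces_win B -> right_forces_win A).
Proof.
have := not_both_force_win B; have := not_both_force_win A.
rewrite /outcome_of; case: (left_forces_win A) (right_forces_win A)
  (left_forces_win B) (right_forces_win B) => [] [] [] [] exclA exclB;
  by [case/negP: (exclA isT) | case/negP: (exclB isT) | split=> // -[]; auto].
Qed.

Lemma outcome_ge_refl o : outcome_ge o o.
Proof. exact: leqnn. Qed.

Lemma outcome_ge_anti o1 o2 : outcome_ge o1 o2 -> outcome_ge o2 o1 -> o1 = o2.
Proof. by case: o1 o2 => [] []. Qed.

(** Left plays in B by imitating a play in A, since each Left move a of A has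
a counterpart b in B such that each answer of Right to b is at best as good for
Right as some answer to a. The same condition lets Right carry a win from B
over to A. Without a Left move in A the condition would be void, although A
may be a draw and B a win for Right. *)
Lemma outcome_ge_simulation A B :
    0 < nleft A ->
    (forall a, exists b, forall s, exists r,
       outcome_ge (outcome_of (@round_option B b s))
                  (outcome_of (@round_option A a r))) ->
  outcome_ge (outcome_of B) (outcome_of A).
Proof.
move=> A_gt0 sim; have [b0 sim0] := sim (Ordinal A_gt0).
have B_gt0 : 0 < nleft B by apply: leq_ltn_trans (ltn_ord b0).
apply/outcome_geP; rewrite !left_forces_winE !right_forces_winE.
rewrite A_gt0 B_gt0 (gtn_eqF A_gt0) (gtn_eqF B_gt0) /=.
have [-> // | B_neq0] := eqVneq (nright B) 0.
(* Right can move in B, hence also in A: the move simulating that one. *)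
have [A_eq0 | _] := eqVneq (nright A) 0.
  have [r _] := sim0 (Ordinal (etrans (lt0n _) B_neq0)).
  by have := ltn_ord r; rewrite [X in _ < X]A_eq0.
split.
  case/existsP=> a /forallP winL; have [b simab] := sim a.
  apply/existsP; exists b; apply/forallP => s.
  by have [r /outcome_geP[toB _]] := simab s; apply/toB/winL.
move/forallP=> winR; apply/forallP => a; have [b simab] := sim a.
have /existsP[s winRs] := winR b.
have [r /outcome_geP[_ toA]] := simab s.
by apply/existsP; exists r; apply: toA.
Qed.

(** The same-round options of a sum, indexed by the summand in which each player
moves rather than by positions in the concatenated lists of moves. *)
Definition add_round (G X : crgame)
    (u : 'I_(nleft G) + 'I_(nleft X)) (v : 'I_(nright G) + 'I_(nright X)) :=
  match u, v with
  | inl a, inl b => round_option a b + X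
  | inr k, inr l => G + round_option k l
  | inl a, inr l => left_option a + right_option l
  | inr k, inl b => right_option b + left_option k
  end%CR.

Lemma outcome_ge_add A B X :
    0 < nleft A ->
    (forall u, exists v, forall s, exists r,
       outcome_ge (outcome_of (@add_round B X v s))
                  (outcome_of (@add_round A X u r))) ->
  outcome_ge (outcome_of (B + X)%CR) (outcome_of (A + X)%CR).
Proof.
case: A B X => [m n AL AR AS] [p q BL BR BS] [x y XL XR XS] /= A_gt0 sim.
apply: outcome_ge_simulation => [|a] /=; first by rewrite addn_gt0 A_gt0.
have [v simv] := sim (split a); exists (unsplit v) => s.
have [r simr] := simv (split s); exists (unsplit r).
rewrite !unsplitK.
by case: (split a) v (split s) r simr {simv} => [?|?] [?|?] [?|?] [?|?].
Qed.

Theorem theorem5 (G : crgame) (i j : 'I_(nleft G)) (neq_ij : i != j)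
    (h_left : cr_ge (left_option i) (left_option j))
    (h_round : forall r : 'I_(nright G), exists s : 'I_(nright G),
       cr_ge (round_option i r) (round_option j s)) :
  cr_eq (remove_left j) G.
Proof.
have [i' def_i _] : {i' | i = lift j i' & unlift j i = Some i'}.
  by apply: unlift_some; rewrite eq_sym.
have G_gt0 : 0 < nleft G by apply: leq_ltn_trans (ltn_ord i).
have H_gt0 : 0 < nleft (remove_left j) by apply: leq_ltn_trans (ltn_ord i').
elim=> p q XL _ XR _ XS IH; set X := CRGame XL XR XS.
apply: outcome_ge_anti.
  apply: outcome_ge_add => // -[a|k].
    have [a' ->|->] := unliftP j a.
      exists (inl a') => s; exists s.
      by case: s => [b|l]; apply: outcome_ge_refl.
    (* Left plays i where the original strategy plays j. *)
    exists (inl i') => -[b|l] /=; rewrite -def_i.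
      by have [s ge_s] := h_round b; exists (inl s); apply: ge_s.
    by exists (inr l); apply: h_left.
  exists (inr k) => s; exists s.
  by case: s => [b|l] /=; rewrite ?IH; apply: outcome_ge_refl.
apply: outcome_ge_add => // -[a|k].
  exists (inl (lift j a)) => s; exists s.
  by case: s => [b|l]; apply: outcome_ge_refl.
exists (inr k) => s; exists s.
by case: s => [b|l] /=; rewrite ?IH; apply: outcome_ge_refl.
Qed.
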